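(* Let $A\in\mathcal C_n$ have all entries in $\{-1,1\}$. Then there exists $s\in\{-1,1\}^n$ such that $A=ss^T$. Moreover, $A\in\mathcal D_n$ if and only if $s$ contains both signs, and every such nondegenerate matrix is a fixed point of $C$. Thus the correlation map $C$ on $n\times n$ matrices has exactly $2^{n-1}-1$ nondegenerate sign-valued fixed points (i.e. fixed points in $\mathcal C_n\cap\mathcal D_n$ with all entries in $\{-1,1\}$).
   Context: $\mathcal C_n$ is the set of real symmetric positive semidefinite $n\times n$ matrices with unit diagonal. $\mathcal D_n$ is the set of real $n\times n$ matrices all of whose rows are nonconstant. For nonconstant $x,y\in\mathbb R^n$, with means $\bar x,\bar y$, the Pearson correlation is $\operatorname{corr}(x,y)=\frac{\sum_k(x_k-\bar x)(y_k-\bar y)}{\sqrt{\sum_k(x_k-\bar x)^2\sum_k(y_k-\bar y)^2}}$. For $A\in\mathcal D_n$ with rows $r_1,\dots,r_n$, $[C(A)]_{ij}=\operatorname{corr}(r_i,r_j)$; a fixed point of $C$ is $A\in\mathcal D_n$ with $C(A)=A$. *)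

(* Defs.v *)
From mathcomp Require Import all_boot all_order all_algebra.
From mathcomp Require Import all_classical all_reals.

Set Implicit Arguments.
Unset Strict Implicit.
Unset Printing Implicit Defensive.

Import Order.TTheory GRing.Theory Num.Theory.
Local Open Scope classical_set_scope.
Local Open Scope ring_scope.

Section Correlation.
Variables (R : realType) (n : nat).

Definition psd (A : 'M[R]_n) : Prop :=
  A^T = A /\ forall x : 'cV[R]_n, 0 <= (x^T *m A *m x) 0 0.

Definition correlation_matrices : set 'M[R]_n :=
  [set A | psd A /\ forall i, A i i = 1].

Definition nonconstant (x : 'rV[R]_n) : Prop := forall c, x <> const_mx c.

Definition nonconstant_rows : set 'M[R]_n :=
  [set A | forall i, nonconstant (row i A)].

Definition mean (x : 'rV[R]_n) : R := (\sum_k x 0 k) / n%:R.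

(* Meaningful for nonconstant x and y only: a constant argument makes the
   denominator 0, and the quotient is then 0 by the convention 0^-1 = 0. *)
Definition corr (x y : 'rV[R]_n) : R :=
  (\sum_k (x 0 k - mean x) * (y 0 k - mean y)) /
  Num.sqrt ((\sum_k (x 0 k - mean x) ^+ 2) * (\sum_k (y 0 k - mean y) ^+ 2)).

Definition corr_map (A : 'M[R]_n) : 'M[R]_n :=
  \matrix_(i, j) corr (row i A) (row j A).

(* corr_map is a total function, so its intended domain is imposed here. *)
Definition corr_fixed_points : set 'M[R]_n :=
  [set A | nonconstant_rows A /\ corr_map A = A].

End Correlation.

Arguments correlation_matrices R n : clear implicits.
Arguments nonconstant_rows R n : clear implicits.
Arguments corr_fixed_points R n : clear implicits.

Definition sign_valued (R : realType) (m n : nat) (A : 'M[R]_(m, n)) : Prop :=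
  forall i j, A i j = -1 \/ A i j = 1.

(* Main.v *)
Require Import Defs.
From mathcomp Require Import all_boot all_order all_algebra.
From mathcomp Require Import all_classical all_reals.
From mathcomp Require Import ring lra.
Import Order.TTheory GRing.Theory Num.Theory.
Local Open Scope classical_set_scope.
Local Open Scope ring_scope.

(** The idea is rigidity: in a positive semidefinite matrix with unit diagonal,
    an entry [+1] or [-1] forces the two corresponding Gram vectors to be equal
    or opposite.  So if all entries are signs, the Gram vectors all lie on one
    line and [A = s s^T].  Concretely, testing positivity on three basis vectors
    gives the cocycle relation [A i j = A i k * A j k]
    ([correlation_sign_cocycle]), so that any column of [A] can be taken as [s]
    ([correlation_sign_rank1]).

    The rows of [s s^T] are the vectors [s_i s^T], all proportional to [s^T].
    They are nonconstant exactly when [s] takes both signs, and the correlation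
    of two nonzero multiples of one nonconstant vector is the product of the
    signs of the multipliers ([corr_scale]); hence [s s^T] is reproduced by the
    correlation map.

    For the count, [s] and [-s] give the same matrix, and normalizing
    [s_z = 1] at one chosen index [z] removes this ambiguity.  The fixed points
    then correspond to the sets of positions of [-1] in [s], which are the
    nonempty sets of indices avoiding [z]; there are [2^(n-1) - 1] of them. *)

(** * Sign-valued correlation matrices have rank one *)

Lemma sign_sqr {R : realType} {m n : nat} (A : 'M[R]_(m, n)) i j :
  sign_valued A -> A i j * A i j = 1.
Proof. by case/(_ i j) => ->; rewrite ?mulrNN mulr1. Qed.

Lemma delta_form {R : realType} {n : nat} (A : 'M[R]_n) i j :
  (delta_mx i 0 : 'cV_n)^T *m A *m (delta_mx j 0 : 'cV_n) = (A i j)%:M.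
Proof.
by rewrite trmx_delta -rowE -colE; apply/rowP => k; rewrite !ord1 !mxE eqxx.
Qed.

(** If the product of the three entries were [-1], the quadratic form would take
    the value [-3] at [e_k - A i k e_i - A j k e_j].  Only bilinearity
    is used, so the argument covers coinciding indices as well. *)
Lemma correlation_sign_cocycle {R : realType} {n : nat} (A : 'M[R]_n) i j k :
  correlation_matrices R n A -> sign_valued A -> A i j = A i k * A j k.
Proof.
move=> [[symA posA] diagA] sgnA.
have sym a b : A a b = A b a by rewrite -[in LHS]symA mxE.
pose e a : 'cV[R]_n := delta_mx a 0.
have := posA (e k - A i k *: e i - A j k *: e j).
rewrite !linearB !linearZ /= !mulmxDl -!scalemxAl !mulNmx.
rewrite /e !delta_form !mxE !mulr1n !diagA.
rewrite (sym k i) (sym k j) (sym j i).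
by case: (sgnA i j) (sgnA i k) (sgnA j k) => -> [] -> [] ->; lra.
Qed.

Lemma correlation_sign_rank1 {R : realType} {n : nat} (A : 'M[R]_n) k :
  correlation_matrices R n A -> sign_valued A -> A = col k A *m (col k A)^T.
Proof.
move=> corA sgnA; apply/matrixP => i j.
by rewrite mxE big_ord1 !mxE; apply: correlation_sign_cocycle.
Qed.

(** * Outer squares of sign vectors *)

Section SignVector.
Context {R : realType} {n : nat}.
Implicit Types s : 'cV[R]_n.

Lemma outerE s i j : (s *m s^T) i j = s i 0 * s j 0.
Proof. by rewrite mxE big_ord1 mxE. Qed.

Lemma outer_row s i : row i (s *m s^T) = s i 0 *: s^T.
Proof. by apply/rowP => j; rewrite mxE outerE !mxE. Qed.

Lemma sign_valued_outer s : sign_valued s -> sign_valued (s *m s^T).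
Proof.
move=> sgns i j; rewrite outerE.
by case: (sgns i 0) (sgns j 0) => -> [] ->; rewrite ?mulrNN ?mulr1 ?mul1r; auto.
Qed.

Lemma correlation_outer s :
  sign_valued s -> correlation_matrices R n (s *m s^T).
Proof.
move=> sgns; split; last by move=> i; rewrite outerE sign_sqr.
split=> [|x]; first by rewrite trmx_mul trmxK.
have -> : x^T *m (s *m s^T) *m x = (x^T *m s) *m (x^T *m s)^T.
  by rewrite trmx_mul trmxK !mulmxA.
by rewrite mxE big_ord1 [_^T _ _]mxE -expr2 sqr_ge0.
Qed.

Lemma nonconstant_rows_outerP s : (0 < n)%N -> sign_valued s ->
  nonconstant_rows R n (s *m s^T) <->
  (exists i, s i 0 = 1) /\ (exists j, s j 0 = -1).
Proof.
move=> n_gt0 sgns; split=> [ncs | [[p sp] [q sq]] i c].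
- have ncs_tr c : ~ forall j, s j 0 = c.
    move=> sc; apply: (ncs (Ordinal n_gt0) (c * c)); rewrite outer_row.
    by apply/rowP => j; rewrite !mxE !sc.
  split; apply: contrapT => nex.
  + by apply: (ncs_tr (-1)) => j; case: (sgns j 0) => // sj; case: nex; exists j.
  + by apply: (ncs_tr 1) => j; case: (sgns j 0) => // sj; case: nex; exists j.
- rewrite outer_row => /rowP rowc; have := rowc p; have := rowc q.
  by rewrite !mxE sp sq; case: (sgns i 0) => ->; lra.
Qed.

End SignVector.

(** * Correlation of proportional vectors *)

Section CorrScale.
Context {R : realType} {n : nat}.
Implicit Types x : 'rV[R]_n.

Lemma mean_scale a x : mean (a *: x) = a * mean x.
Proof. by rewrite /mean mulrA mulr_sumr; under eq_bigr do rewrite mxE. Qed.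

Lemma nonconstant_scale a x : nonconstant (a *: x) -> nonconstant x.
Proof.
move=> ncax c xc; apply: (ncax (a * c)).
by rewrite xc; apply/rowP => j; rewrite !mxE.
Qed.

Lemma variance_gt0 x : nonconstant x -> 0 < \sum_k (x 0 k - mean x) ^+ 2.
Proof.
move=> ncx; rewrite lt0r sumr_ge0 ?andbT; last by move=> k _; exact: sqr_ge0.
apply/eqP => /psumr_eq0P sum0; apply: (ncx (mean x)); apply/rowP => k.
have /eqP := sum0 (fun k _ => sqr_ge0 _) k isT.
by rewrite sqrf_eq0 subr_eq0 mxE => /eqP.
Qed.

(** Scaling by [a] and [b] multiplies the covariance by [a * b] and the
    normalizing factor by [`|a * b|]. *)
Lemma corr_scale a b x :
  nonconstant x -> corr (a *: x) (b *: x) = Num.sg (a * b).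
Proof.
move=> /variance_gt0; set v := \sum_k _ => v_gt0.
have covE c d :
    \sum_k ((c *: x) 0 k - mean (c *: x)) * ((d *: x) 0 k - mean (d *: x)) =
    (c * d) * v.
  by rewrite mulr_sumr; apply: eq_bigr => k _; rewrite !mean_scale !mxE; ring.
have varE c : \sum_k ((c *: x) 0 k - mean (c *: x)) ^+ 2 = (c * c) * v.
  by rewrite -covE; apply: eq_bigr => k _; rewrite expr2.
rewrite /corr covE !varE.
have -> : a * a * v * (b * b * v) = (a * b * v) ^+ 2 by ring.
rewrite sqrtr_sqr normrM (gtr0_norm v_gt0) -mulf_div divff ?gt_eqF // mulr1.
have [->|ab_neq0] := eqVneq (a * b) 0; first by rewrite mul0r sgr0.
by rewrite {1}[a * b]numEsg mulfK ?normr_eq0.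
Qed.

End CorrScale.

Lemma corr_fixed_outer {R : realType} {n : nat} (s : 'cV[R]_n) :
  sign_valued s -> nonconstant_rows R n (s *m s^T) ->
  corr_fixed_points R n (s *m s^T).
Proof.
move=> sgns ncs; split=> //; apply/matrixP => i j.
have ncst : nonconstant s^T.
  by apply: (@nonconstant_scale _ _ (s i 0)); rewrite -outer_row; exact: ncs.
rewrite mxE !outer_row corr_scale // outerE.
by case: (sgns i 0) (sgns j 0) => -> [] ->;
   rewrite ?mulrNN ?mulr1 ?mul1r ?sgrN sgr1.
Qed.

(** * Counting *)

Lemma card_finpred (T : finType) (P : pred T) :
  ([set x | P x] #= `I_#|P|)%card.
Proof.
have -> : [set x | P x] = @enum_val T P @` [set: 'I_#|P|].
  apply/seteqP; split=> [x Px | _ [i _ <-]]; last exact: enum_valP.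
  by exists (enum_rank_in (Px : x \in P) x) => //; rewrite enum_rankK_in.
apply: (card_eq_trans (inj_card_eq _)).
  by move=> i j _ _; exact: enum_val_inj.
by rewrite card_eq_sym card_II.
Qed.

Lemma card_nonempty_avoiding {n : nat} (z : 'I_n) :
  #|[pred S : {set 'I_n} | (z \notin S) && (S != finset.set0)]| =
  (2 ^ (n - 1) - 1)%N.
Proof.
have -> : #|[pred S : {set 'I_n} | (z \notin S) && (S != finset.set0)]| =
          #|powerset [set~ z]%SET :\ finset.set0|.
  by apply: eq_card => S; rewrite !inE finset.subsetC finset.sub1set inE andbC.
have := cardsD1 finset.set0 (powerset [set~ z]%SET).
rewrite card_powerset cardsC1 card_ord powersetE finset.sub0set !subn1 => ->.
by rewrite add1n.
Qed.

Section SignsOfSet.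
Context {R : realType} {n : nat}.
Implicit Types S : {set 'I_n}.

Definition sign_vector S : 'cV[R]_n := \col_i (-1) ^+ (i \in S).

Lemma sign_vectorP S : sign_valued (sign_vector S).
Proof.
by move=> i j; rewrite mxE; case: (i \in S); rewrite ?expr0 ?expr1; auto.
Qed.

(** The normalization at [z] makes column [z] of the outer square equal to the
    sign vector itself, from which the set is read off. *)
Lemma sign_vector_outer_inj z S S' : z \notin S -> z \notin S' ->
  sign_vector S *m (sign_vector S)^T = sign_vector S' *m (sign_vector S')^T ->
  S = S'.
Proof.
move=> /negbTE zS /negbTE zS' eqSS'; apply/setP => i.
have := congr1 (fun A : 'M_n => A i z) eqSS'.
rewrite !outerE !mxE zS zS' !mulr1.
exact: signr_inj.
Qed.

Lemma sign_vector_nonconstant z S : z \notin S ->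
  nonconstant_rows R n (sign_vector S *m (sign_vector S)^T) <->
  (S != finset.set0).
Proof.
move=> zS; have n_gt0 : (0 < n)%N by exact: leq_ltn_trans (ltn_ord z).
have [pq qp] := nonconstant_rows_outerP _ n_gt0 (sign_vectorP S).
split=> [/pq [_ [j]] | /set0Pn [j jS]].
- rewrite mxE; case: (boolP (j \in S)) => [jS _ | _].
    by apply/set0Pn; exists j.
  by rewrite expr0; lra.
- by apply: qp; split; [exists z | exists j]; rewrite mxE ?(negbTE zS) ?jS.
Qed.

Lemma sign_fixed_points_image (z : 'I_n) :
  [set A : 'M[R]_n | [/\ correlation_matrices R n A, nonconstant_rows R n A,
     sign_valued A & corr_fixed_points R n A]] =
  (fun S => sign_vector S *m (sign_vector S)^T) @`
    [set S : {set 'I_n} | (z \notin S) && (S != finset.set0)].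
Proof.
apply/seteqP; split=> [A [corA ncA sgnA _] | _ [S /andP[zS S0] <-]] /=.
- (* Column [z] of [A] is the representative [s] normalized by [s_z = 1]. *)
  pose S := [set i | A i z == -1]%SET.
  have zS : z \notin S by rewrite inE corA.2; apply/eqP; lra.
  have sE : sign_vector S = col z A.
    apply/colP => i; rewrite !mxE inE.
    case: (sgnA i z) => ->; first by rewrite eqxx expr1.
    by rewrite [_ == _](_ : _ = false) //; apply/eqP; lra.
  have AE : sign_vector S *m (sign_vector S)^T = A.
    by rewrite sE -correlation_sign_rank1.
  exists S => //; rewrite zS /=.
  by apply/(sign_vector_nonconstant _ _ zS); rewrite AE.
- have sgnS := sign_vectorP S.
  have ncS := (sign_vector_nonconstant _ _ zS).2 S0.
  split=> //; [exact: correlation_outer | exact: sign_valued_outer |].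
  exact: corr_fixed_outer.
Qed.

End SignsOfSet.

Theorem proposition3 (R : realType) (n : nat) (n_gt0 : (0 < n)%N) :
  (forall A : 'M[R]_n, correlation_matrices R n A -> sign_valued A ->
    [/\ exists s : 'cV[R]_n, sign_valued s /\ A = s *m s^T,
        forall s : 'cV[R]_n, sign_valued s -> A = s *m s^T ->
          (nonconstant_rows R n A <->
           (exists i, s i 0 = 1) /\ (exists j, s j 0 = -1))
      & nonconstant_rows R n A -> corr_fixed_points R n A])
  /\ ([set A : 'M[R]_n | [/\ correlation_matrices R n A, nonconstant_rows R n A,
        sign_valued A & corr_fixed_points R n A]]
     #= `I_(2 ^ (n - 1) - 1)%N)%card.
Proof.
pose z := Ordinal n_gt0; split=> [A corA sgnA|].
- have sgnz : sign_valued (col z A) by move=> i j; rewrite mxE; exact: sgnA.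
  have Az := correlation_sign_rank1 A z corA sgnA.
  split=> [|s sgns ->|]; first by exists (col z A).
  + exact: nonconstant_rows_outerP.
  + by rewrite Az; exact: corr_fixed_outer.
- rewrite (sign_fixed_points_image z) -(card_nonempty_avoiding z).
  apply: (card_eq_trans (inj_card_eq _)); last exact: card_finpred.
  move=> S S1; rewrite !inE => /andP[zS _] /andP[zS1 _].
  exact: (sign_vector_outer_inj z S S1 zS zS1).
Qed.
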